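(* Let $\lambda\in\mathbb{R}$. For every integer $n\ge 0$, \[ \mathrm{Bel}_{n+1,\lambda}(x)=x\Big(\mathrm{Bel}_{n,\lambda}'(x)+\mathrm{Bel}_{n,\lambda}(x)\Big)-n\lambda\,\mathrm{Bel}_{n,\lambda}(x), \] where $\mathrm{Bel}'_{n,\lambda}(x)=\frac{d}{dx}\mathrm{Bel}_{n,\lambda}(x)$.
   Context: For $\lambda\in\mathbb{R}$, $(x)_{0,\lambda}=1$ and $(x)_{n,\lambda}=x(x-\lambda)\cdots(x-(n-1)\lambda)$ for $n\ge1$. The degenerate exponential is $e_\lambda(t)=\sum_{k\ge0}(1)_{k,\lambda}t^k/k!$ (equal to $(1+\lambda t)^{1/\lambda}$ for $\lambda\ne0$, $e^t$ for $\lambda=0$). The degenerate Bell polynomials are defined by $e^{x(e_{\lambda}(t)-1)}=\sum_{n=0}^{\infty}\mathrm{Bel}_{n,\lambda}(x)\frac{t^{n}}{n!}$. *)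

(* Defs.v *)
From Stdlib Require Import Reals Factorial Lra Lia Wf_nat PeanoNat.
From Coquelicot Require Import Coquelicot.
Open Scope R_scope.

Fixpoint degenerate_falling (lambda x : R) (n : nat) : R :=
  match n with
  | O => 1
  | S k => degenerate_falling lambda x k * (x - INR k * lambda)
  end.

(* Only the values near t = 0 matter: for lambda <> 0 with 1 / lambda not a
   natural number, the series has radius of convergence 1 / |lambda|. *)
Definition degenerate_exp (lambda t : R) : R :=
  PSeries (fun k => degenerate_falling lambda 1 k / INR (fact k)) t.

(* The radius r may depend on x. By uniqueness of power series coefficients, at
   most one family Bel satisfies this; [degenerate_Bell_exists] provides one. *)
Definition is_degenerate_Bell (lambda : R) (Bel : nat -> R -> R) : Prop :=
  forall x : R, exists r : R, 0 < r /\
    forall t : R, Rabs t < r ->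
      is_pseries (fun n => Bel n x / INR (fact n)) t
        (exp (x * (degenerate_exp lambda t - 1))).

Lemma CV_radius_geom (a : nat -> R) (K : R) :
  0 < K -> (forall n, Rabs (a n) <= K ^ n) -> Rbar_le (/ K) (CV_radius a).
Proof.
intros HK Ha.
apply (proj1 (CV_radius_bounded a)).
exists 1; intros n.
rewrite Rabs_mult, <- RPow_abs, (Rabs_pos_eq (/ K)) by (left; now apply Rinv_0_lt_compat).
rewrite pow_inv.
assert (0 < K ^ n) by now apply pow_lt.
apply Rmult_le_reg_r with (K ^ n); [assumption|].
rewrite Rmult_assoc, Rinv_l by lra.
specialize (Ha n); lra.
Qed.

Section Existence.

Variables lambda x : R.

Let eps (k : nat) : R := degenerate_falling lambda 1 k / INR (fact k).

Let L : R := 1 + Rabs lambda.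

Let Hl : 0 <= Rabs lambda := Rabs_pos lambda.

Lemma eps_rec n : INR (S n) * eps (S n) = eps n - lambda * (INR n * eps n).
Proof.
unfold eps; cbn [degenerate_falling].
rewrite fact_simpl, mult_INR.
assert (INR (S n) <> 0) by (apply not_0_INR; lia).
assert (INR (fact n) <> 0) by apply INR_fact_neq_0.
field; split; assumption.
Qed.

Lemma eps_bound n : Rabs (eps n) <= L ^ n.
Proof.
induction n as [|n IH].
- unfold eps; simpl; rewrite Rdiv_1_r, Rabs_R1; lra.
- assert (Hn : 0 <= INR n) by apply pos_INR.
  assert (HS : 0 < INR (S n)) by (apply lt_0_INR; lia).
  apply Rmult_le_reg_l with (INR (S n)); [assumption|].
  rewrite <- (Rabs_pos_eq (INR (S n))) at 1 by lra.
  rewrite <- Rabs_mult, eps_rec.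
  replace (eps n - lambda * (INR n * eps n))
    with ((1 - lambda * INR n) * eps n) by ring.
  rewrite Rabs_mult.
  assert (H1 : Rabs (1 - lambda * INR n) <= INR (S n) * L).
  { eapply Rle_trans; [apply Rabs_triang|].
    rewrite Rabs_Ropp, Rabs_mult, Rabs_R1, (Rabs_pos_eq (INR n)) by assumption.
    rewrite S_INR; unfold L; nra. }
  simpl pow; rewrite <- Rmult_assoc.
  apply Rmult_le_compat; auto using Rabs_pos.
Qed.

(* Coefficients of the power series solution g of
   (1 + lambda t) g' = x e_lambda(t) g, g(0) = 1. *)
Fixpoint sol_upto (n : nat) : nat -> R :=
  match n with
  | O => fun _ => 1
  | S n' => fun m =>
      if Nat.leb m n' then sol_upto n' m
      else (x * PS_mult eps (sol_upto n') n' - lambda * (INR n' * sol_upto n' n'))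
             / INR (S n')
  end.

Let c (n : nat) : R := sol_upto n n.

Lemma sol_upto_stable n m : (m <= n)%nat -> sol_upto n m = c m.
Proof.
induction n as [|n IH]; intros Hm.
- now replace m with 0%nat by lia.
- destruct (Nat.eq_dec m (S n)) as [->|Hne]; [reflexivity|].
  cbn [sol_upto].
  rewrite (proj2 (Nat.leb_le m n)) by lia.
  apply IH; lia.
Qed.

Lemma c_rec n : INR (S n) * c (S n) = x * PS_mult eps c n - lambda * (INR n * c n).
Proof.
assert (INR (S n) <> 0) by (apply not_0_INR; lia).
unfold c at 1; cbn [sol_upto].
rewrite (proj2 (Nat.leb_gt (S n) n)) by lia.
replace (PS_mult eps (sol_upto n) n) with (PS_mult eps c n).
- unfold c; now field.
- apply sum_eq; intros i Hi; now rewrite sol_upto_stable by lia.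
Qed.

Let K : R := L + Rabs x.

Lemma K_ge_1 : 1 <= K.
Proof. assert (Hx := Rabs_pos x); unfold K, L; lra. Qed.

Lemma eps_bound_K n : Rabs (eps n) <= K ^ n.
Proof.
eapply Rle_trans; [apply eps_bound|].
assert (Hx := Rabs_pos x).
apply pow_incr; unfold K, L; lra.
Qed.

Lemma c_bound n : Rabs (c n) <= K ^ n.
Proof.
induction n as [n IH] using (well_founded_induction lt_wf).
destruct n as [|n].
- unfold c; simpl; rewrite Rabs_R1; lra.
- assert (Hn : 0 <= INR n) by apply pos_INR.
  assert (HS : 0 < INR (S n)) by (apply lt_0_INR; lia).
  assert (HKn : 0 < K ^ n) by (apply pow_lt; assert (H := K_ge_1); lra).
  apply Rmult_le_reg_l with (INR (S n)); [assumption|].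
  rewrite <- (Rabs_pos_eq (INR (S n))) at 1 by lra.
  rewrite <- Rabs_mult, c_rec.
  assert (HP : Rabs (PS_mult eps c n) <= INR (S n) * K ^ n).
  { unfold PS_mult.
    eapply Rle_trans; [apply Rsum_abs|].
    eapply Rle_trans; [apply sum_Rle with (Bn := fun _ => K ^ n)|].
    - intros k Hk; rewrite Rabs_mult.
      replace n with (k + (n - k))%nat at 2 by lia.
      rewrite pow_add.
      apply Rmult_le_compat; auto using Rabs_pos, eps_bound_K.
      apply IH; lia.
    - rewrite sum_cte; lra. }
  eapply Rle_trans; [apply Rabs_triang|].
  rewrite Rabs_Ropp, !Rabs_mult, (Rabs_pos_eq (INR n)) by assumption.
  assert (Hc : Rabs (c n) <= K ^ n) by (apply IH; lia).
  assert (Hx := Rabs_pos x).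
  assert (H1 : Rabs x * Rabs (PS_mult eps c n) <= Rabs x * (INR (S n) * K ^ n))
    by now apply Rmult_le_compat_l.
  assert (H2 : Rabs lambda * (INR n * Rabs (c n)) <= Rabs lambda * (INR (S n) * K ^ n)).
  { apply Rmult_le_compat_l; [assumption|].
    apply Rmult_le_compat; auto using Rabs_pos.
    rewrite S_INR; lra. }
  rewrite <- tech_pow_Rmult.
  apply Rle_trans with ((1 + Rabs lambda + Rabs x) * (INR (S n) * K ^ n)).
  + assert (0 < INR (S n) * K ^ n) by now apply Rmult_lt_0_compat.
    lra.
  + right; fold L K; ring.
Qed.

Lemma shifted_ode (a b : nat -> R) (t : R) :
  Rbar_lt (Rabs t) (CV_radius a) ->
  (forall n, INR (S n) * a (S n) = b n - lambda * (INR n * a n)) ->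
  (1 + lambda * t) * PSeries (PS_derive a) t = PSeries b t.
Proof.
intros Ht Hrec.
assert (He : ex_pseries (PS_derive a) t) by now apply ex_pseries_derive.
replace ((1 + lambda * t) * PSeries (PS_derive a) t)
  with (PSeries (PS_derive a) t + lambda * (t * PSeries (PS_derive a) t)) by ring.
rewrite <- PSeries_incr_1, <- PSeries_scal, <- PSeries_plus.
- apply PSeries_ext; intros n.
  unfold PS_plus, PS_scal, PS_derive, PS_incr_1, plus, scal; simpl.
  unfold mult; simpl.
  destruct n as [|n].
  + specialize (Hrec 0%nat); simpl in Hrec; unfold zero; simpl; lra.
  + specialize (Hrec (S n)).
    change (INR (S (S n)) * a (S (S n)) + lambda * (INR (S n) * a (S n)) = b (S n)).
    lra.
- exact He.
- apply ex_pseries_scal; [apply Rmult_comm|].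
  now apply ex_pseries_incr_1.
Qed.

Lemma const_of_derive_0 (f : R -> R) (r t : R) :
  Rabs t < r -> (forall s, Rabs s < r -> is_derive f s 0) -> f t = f 0.
Proof.
intros Ht Hf.
destruct (Rtotal_order t 0) as [H|[->|H]]; [|reflexivity|symmetry];
  apply (eq_is_derive f); try assumption;
  intros s Hs; apply Hf; revert Ht; unfold Rabs;
  destruct (Rcase_abs t), (Rcase_abs s); lra.
Qed.

Lemma gf_solution (t : R) :
  Rabs t < / K -> is_pseries c t (exp (x * (degenerate_exp lambda t - 1))).
Proof.
assert (HK := K_ge_1).
assert (Rc : forall s, Rabs s < / K -> Rbar_lt (Rabs s) (CV_radius c)).
{ intros s Hs; apply Rbar_lt_le_trans with (Finite (/ K)); [exact Hs|].
  apply CV_radius_geom; [lra|apply c_bound]. }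
assert (Re : forall s, Rabs s < / K -> Rbar_lt (Rabs s) (CV_radius eps)).
{ intros s Hs; apply Rbar_lt_le_trans with (Finite (/ K)); [exact Hs|].
  apply CV_radius_geom; [lra|apply eps_bound_K]. }
intros Ht.
set (H := fun s => PSeries c s * exp (- (x * (PSeries eps s - 1)))).
assert (HH : H t = H 0).
{ apply const_of_derive_0 with (/ K); [assumption|].
  intros s Hs.
  assert (Dc := is_derive_PSeries c s (Rc s Hs)).
  assert (De := is_derive_PSeries eps s (Re s Hs)).
  assert (Oc := shifted_ode c (PS_scal x (PS_mult eps c)) s (Rc s Hs) c_rec).
  assert (Oe := shifted_ode eps eps s (Re s Hs) eps_rec).
  rewrite PSeries_scal, PSeries_mult in Oc by auto.
  assert (Hne : 1 + lambda * s <> 0).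
  { assert (Rabs (lambda * s) < 1).
    { rewrite Rabs_mult.
      assert (H1 : Rabs s * K < 1).
      { replace 1 with (/ K * K) by (field; lra).
        apply Rmult_lt_compat_r; lra. }
      assert (Hs0 := Rabs_pos s); assert (Hx := Rabs_pos x).
      unfold K, L in H1; nra. }
    intros E; replace (lambda * s) with (-1) in * by lra.
    rewrite Rabs_left in *; lra. }
  evar_last.
  - unfold H; auto_derive.
    + repeat split; [now exists (PSeries (PS_derive c) s)
                    |now exists (PSeries (PS_derive eps) s)].
    + reflexivity.
  - change (fun y : R => PSeries eps y) with (PSeries eps).
    change (fun y : R => PSeries c y) with (PSeries c).
    rewrite (is_derive_unique _ _ _ Dc), (is_derive_unique _ _ _ De).
    apply Rmult_eq_reg_l with (1 + lambda * s); [|assumption].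
    match goal with |- context [exp ?u] => set (E := exp u) end.
    transitivity (((1 + lambda * s) * PSeries (PS_derive c) s
       - x * ((1 + lambda * s) * PSeries (PS_derive eps) s) * PSeries c s) * E).
    + ring.
    + rewrite Oc, Oe; ring. }
assert (H0 : H 0 = 1).
{ unfold H; rewrite !PSeries_0; unfold c, eps; simpl.
  replace (- (x * (1 / 1 - 1))) with 0 by field.
  rewrite exp_0; ring. }
rewrite H0 in HH; unfold H in HH; rewrite exp_Ropp in HH.
change (degenerate_exp lambda t) with (PSeries eps t).
assert (Hp := exp_pos (x * (PSeries eps t - 1))).
replace (exp (x * (PSeries eps t - 1))) with (PSeries c t).
- apply PSeries_correct, CV_radius_inside, Rc, Ht.
- set (E := exp (x * (PSeries eps t - 1))) in *.
  replace (PSeries c t) with (PSeries c t * / E * E) by (field; lra).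
  rewrite HH; ring.
Qed.

End Existence.

Lemma degenerate_Bell_exists (lambda : R) :
  exists Bel : nat -> R -> R, is_degenerate_Bell lambda Bel.
Proof.
exists (fun n x => sol_upto lambda x n n * INR (fact n)); intros x.
exists (/ (1 + Rabs lambda + Rabs x)); split.
- assert (Hl := Rabs_pos lambda); assert (Hx := Rabs_pos x).
  apply Rinv_0_lt_compat; lra.
- intros t Ht.
  apply is_pseries_ext with (fun n => sol_upto lambda x n n).
  + intros n.
    change (sol_upto lambda x n n
            = sol_upto lambda x n n * INR (fact n) / INR (fact n) :> R).
    field; apply INR_fact_neq_0.
  + now apply gf_solution.
Qed.

(* Main.v *)
Require Import Defs.
From Stdlib Require Import Reals.
From Coquelicot Require Import Coquelicot.
From Stdlib Require Import Factorial PeanoNat Lra Lia Wf_nat.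
Open Scope R_scope.

(** Put [c_n(x) = Bel_n(x) / n!], [eps_k = (1)_{k,lambda} / k!], and write [*] for
    the Cauchy product of coefficient sequences.  Since
    [exp ((x + y) (e - 1)) = exp (x (e - 1)) exp (y (e - 1))],
    the sequences satisfy [c(x + y) = c(x) * c(y)], so their derivatives
    everywhere follow from those at [0]:
    [c'(x) = c'(0) * c(x) = (eps - c(0)) * c(x) = eps * c(x) - c(x)].
    The differential equation [(1 + lambda t) g' = x e_lambda(t) g] satisfied by
    [g = exp (x (e_lambda(t) - 1))] reads
    [(n + 1) c_{n+1} = x (eps * c)_n - lambda n c_n] on coefficients, and
    replacing [eps * c] by [c' + c] gives the recurrence. *)

(** * Power series coefficients and Cauchy products *)

Lemma CV_radius_pos (a : nat -> R) (t : R) :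
  t <> 0 -> ex_pseries a t -> Rbar_lt 0 (CV_radius a).
Proof.
intros Ht Ha.
apply Rbar_lt_le_trans with (Rabs t); [now apply Rabs_pos_lt|].
destruct (Rbar_le_lt_dec (Rabs t) (CV_radius a)) as [|Hlt]; [assumption|].
exfalso; apply (CV_disk_outside _ _ Hlt).
apply ex_series_lim_0, ex_pseries_R, Ha.
Qed.

(** Convergence at the nonzero point [r / 2] makes both radii positive, and two such series with
    equal sums near 0 have equal coefficients. *)
Lemma is_pseries_coef_unique (a b : nat -> R) (f : R -> R) (r : R) :
  0 < r ->
  (forall t, Rabs t < r -> is_pseries a t (f t)) ->
  (forall t, Rabs t < r -> is_pseries b t (f t)) ->
  forall n, a n = b n.
Proof.
intros Hr Ha Hb n.
assert (H : Rabs (r / 2) < r) by (rewrite Rabs_pos_eq; lra).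
apply PSeries_ext_recip.
- apply CV_radius_pos with (r / 2); [lra|]; eexists; now apply Ha.
- apply CV_radius_pos with (r / 2); [lra|]; eexists; now apply Hb.
- exists (mkposreal r Hr); intros t Ht.
  assert (Ht' : Rabs t < r).
  { change (Rabs (t - 0) < r) in Ht; now rewrite Rminus_0_r in Ht. }
  rewrite (is_pseries_unique _ _ _ (Ha t Ht')).
  symmetry; apply is_pseries_unique, Hb, Ht'.
Qed.

(** Leibniz rule; asking only for indices [k <= n] lets it be applied to a strong induction
    hypothesis. *)
Lemma is_derive_PS_mult (a b : R -> nat -> R) (a' b' : nat -> R) (x : R) (n : nat) :
  (forall k, (k <= n)%nat -> is_derive (fun y => a y k) x (a' k)) ->
  (forall k, (k <= n)%nat -> is_derive (fun y => b y k) x (b' k)) ->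
  is_derive (fun y => PS_mult (a y) (b y) n) x
    (PS_mult a' (b x) n + PS_mult (a x) b' n).
Proof.
intros Ha Hb; unfold PS_mult.
rewrite <- plus_sum, <- sum_n_Reals.
apply is_derive_ext
  with (fun y => sum_n (fun k => a y k * b y (n - k)%nat) n).
- intros y; apply sum_n_Reals.
- apply is_derive_sum_n with (f := fun k y => a y k * b y (n - k)%nat).
  intros k Hk; apply (is_derive_mult (fun y => a y k) (fun y => b y (n - k)%nat)).
  + now apply Ha.
  + apply Hb; lia.
  + exact Rmult_comm.
Qed.

Lemma PS_mult_minus_l (a b c : nat -> R) (n : nat) :
  PS_mult (fun k => a k - b k) c n = PS_mult a c n - PS_mult b c n.
Proof.
unfold PS_mult; rewrite <- minus_sum.
apply sum_eq; intros; ring.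
Qed.

Lemma PS_mult_0_r (a b : nat -> R) (n : nat) :
  (forall k, b k = 0) -> PS_mult a b n = 0.
Proof.
intros Hb; unfold PS_mult; apply sum_eq_R0; intros; rewrite Hb; ring.
Qed.

Lemma PS_mult_1_r (a b : nat -> R) (n : nat) :
  b 0%nat = 1 -> (forall k, b (S k) = 0) -> PS_mult a b n = a n.
Proof.
intros H0 HS; unfold PS_mult; destruct n as [|n].
- simpl; rewrite H0; ring.
- rewrite tech5, Nat.sub_diag, H0, sum_eq_R0; [ring|].
  intros k Hk; replace (S n - k)%nat with (S (n - k)) by lia.
  rewrite HS; ring.
Qed.

(** * The coefficients as functions of [x]: addition rule and derivative *)

Section Coefficients.

Variable lambda : R.

Let eps (k : nat) : R := degenerate_falling lambda 1 k / INR (fact k).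

Let c (x : R) (n : nat) : R := sol_upto lambda x n n.

Let radius (x : R) : R := / (1 + Rabs lambda + Rabs x).

Lemma radius_pos x : 0 < radius x.
Proof.
assert (H1 := Rabs_pos lambda); assert (H2 := Rabs_pos x).
apply Rinv_0_lt_compat; lra.
Qed.

Lemma CV_radius_sol_upto (x t : R) :
  Rabs t < radius x -> Rbar_lt (Rabs t) (CV_radius (c x)).
Proof.
intros Ht.
apply Rbar_lt_le_trans with (radius x); [exact Ht|].
assert (H1 := Rabs_pos lambda); assert (H2 := Rabs_pos x).
apply CV_radius_geom; [lra|apply c_bound].
Qed.

Lemma sol_upto_add (x y : R) (n : nat) : c (x + y) n = PS_mult (c x) (c y) n.
Proof.
apply is_pseries_coef_unique with
  (f := fun t => exp ((x + y) * (degenerate_exp lambda t - 1)))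
  (* All three expansions hold on the smallest of the discs. *)
  (r := Rmin (radius (x + y)) (Rmin (radius x) (radius y))).
- repeat apply Rmin_glb_lt; apply radius_pos.
- intros t Ht; apply gf_solution.
  eapply Rlt_le_trans; [exact Ht|apply Rmin_l].
- intros t Ht.
  assert (Hx : Rabs t < radius x).
  { eapply Rlt_le_trans; [exact Ht|].
    eapply Rle_trans; [apply Rmin_r|apply Rmin_l]. }
  assert (Hy : Rabs t < radius y).
  { eapply Rlt_le_trans; [exact Ht|].
    eapply Rle_trans; [apply Rmin_r|apply Rmin_r]. }
  rewrite Rmult_plus_distr_r, exp_plus.
  apply is_pseries_mult; auto using CV_radius_sol_upto; now apply gf_solution.
Qed.

(** At [x = 0] the recurrence loses its product term, and its factor [n] kills [c 0 0 = 1] at the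
    start. Hence [c 0] is the unit of the Cauchy product. *)
Lemma sol_upto_0 (n : nat) : c 0 (S n) = 0.
Proof.
assert (HS : forall m, INR (S m) <> 0) by (intros; apply not_0_INR; lia).
induction n as [|n IH].
- assert (H := c_rec lambda 0 0).
  apply Rmult_eq_reg_l with (INR 1); [|apply HS].
  unfold c; rewrite H; simpl; ring.
- assert (H := c_rec lambda 0 (S n)).
  apply Rmult_eq_reg_l with (INR (S (S n))); [|apply HS].
  unfold c in *; rewrite H, IH; ring.
Qed.

(** Differentiating the recurrence for [c x] at 0 gives the recurrence satisfied by [eps - c 0]. *)
Lemma is_derive_sol_upto_0 (n : nat) :
  is_derive (fun x => c x n) 0 (eps n - c 0 n).
Proof.
induction n as [n IH] using (well_founded_induction lt_wf).
destruct n as [|n].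
- replace (eps 0 - c 0 0) with 0 by (unfold eps, c; simpl; field).
  apply (is_derive_const 1).
- assert (HS : INR (S n) <> 0) by (apply not_0_INR; lia).
  assert (He : INR (S n) * eps (S n) = eps n - lambda * (INR n * eps n))
    by apply eps_rec.
  assert (Hc : forall x, INR (S n) * c x (S n)
                 = x * PS_mult eps (c x) n - lambda * (INR n * c x n))
    by (intros; apply c_rec).
  apply is_derive_ext with
    (fun x => (x * PS_mult eps (c x) n - lambda * (INR n * c x n)) / INR (S n)).
  { intros x; rewrite <- Hc.
    change (INR (S n) * c x (S n) / INR (S n) = c x (S n) :> R); now field. }
  assert (DP := is_derive_PS_mult (fun _ => eps) c (fun _ => 0)
    (fun k => eps k - c 0 k) 0 n (fun k _ => is_derive_const (eps k) 0)
    (fun k Hk => IH k (proj2 (Nat.lt_succ_r k n) Hk))).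
  assert (Dc := IH n (Nat.lt_succ_diag_r n)).
  cbv beta in DP.
  (* At 0 the product rule for [x * F x] leaves only [F 0], as [dF] is multiplied by 0. *)
  assert (D : forall (F G : R -> R) (dF dG k s : R), is_derive F 0 dF -> is_derive G 0 dG ->
    is_derive (fun x => (x * F x - lambda * (k * G x)) / s) 0
      ((F 0 - lambda * (k * dG)) / s)).
  { intros F G dF dG k s HF HG; auto_derive.
    - repeat split; eexists; eassumption.
    - change (fun x => G x) with G.
      rewrite (is_derive_unique _ _ _ HG); unfold Rdiv; ring. }
  evar_last; [exact (D _ _ _ _ _ _ DP Dc)|cbv beta].
  rewrite (PS_mult_1_r eps (c 0) n eq_refl sol_upto_0).
  apply Rmult_eq_reg_l with (INR (S n)); [|assumption].
  rewrite (Rmult_minus_distr_l (INR (S n))), He, Hc.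
  field; assumption.
Qed.

Lemma is_derive_sol_upto (x : R) (n : nat) :
  is_derive (fun y => c y n) x (PS_mult eps (c x) n - c x n).
Proof.
assert (D0 := is_derive_PS_mult c (fun _ => c x) (fun k => eps k - c 0 k)
  (fun _ => 0) 0 n (fun k _ => is_derive_sol_upto_0 k)
  (fun k _ => is_derive_const (c x k) 0)).
cbv beta in D0.
(* The addition rule at [0 + x] collapses [c 0 * c x] to [c x]. *)
rewrite (PS_mult_0_r _ (fun _ => 0)), Rplus_0_r, PS_mult_minus_l,
  <- sol_upto_add, Rplus_0_l in D0 by reflexivity.
(* Splitting [y] as [(y - x) + x] moves the derivative from [x] to 0. *)
apply is_derive_ext with (fun y => PS_mult (c (y - x)) (c x) n).
{ intros y; rewrite <- sol_upto_add; f_equal; ring. }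
set (g := fun y => PS_mult (c y) (c x) n) in D0.
evar_last.
- apply (is_derive_comp g (fun y => y - x)).
  + replace (x - x) with 0 by ring; exact D0.
  + auto_derive; [trivial|reflexivity].
- unfold scal; simpl; unfold mult; simpl; ring.
Qed.

End Coefficients.

(** Both families expand the same generating function, so any [Bel] inherits the recurrence and
    derivative of the explicit solution. *)
Lemma degenerate_Bell_sol_upto (lambda : R) (Bel : nat -> R -> R) (n : nat) (x : R) :
  is_degenerate_Bell lambda Bel -> Bel n x = INR (fact n) * sol_upto lambda x n n.
Proof.
intros hBel.
destruct (hBel x) as [r [Hr Hs]].
assert (Hf := INR_fact_neq_0 n).
assert (H : Bel n x / INR (fact n) = sol_upto lambda x n n).
{ apply (is_pseries_coef_unique (fun n => Bel n x / INR (fact n))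
    (fun n => sol_upto lambda x n n)
    (fun t => exp (x * (degenerate_exp lambda t - 1)))
    (Rmin r (/ (1 + Rabs lambda + Rabs x)))).
  - apply Rmin_glb_lt; [assumption|apply radius_pos].
  - intros t Ht; apply Hs.
    eapply Rlt_le_trans; [exact Ht|apply Rmin_l].
  - intros t Ht; apply gf_solution.
    eapply Rlt_le_trans; [exact Ht|apply Rmin_r]. }
rewrite <- H; now field.
Qed.

Theorem theorem4 (lambda : R) (Bel : nat -> R -> R)
    (hBel : is_degenerate_Bell lambda Bel) (n : nat) (x : R) :
  ex_derive (Bel n) x /\
  Bel (S n) x =
    x * (Derive (Bel n) x + Bel n x) - INR n * lambda * Bel n x.
Proof.
assert (HB : forall m y, Bel m y = INR (fact m) * sol_upto lambda y m m)
  by (intros; now apply degenerate_Bell_sol_upto).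
assert (D := is_derive_scal _ x (INR (fact n)) _ (is_derive_sol_upto lambda x n)).
apply is_derive_ext with (g := Bel n) in D; [|intros; now rewrite HB].
split; [eexists; exact D|].
rewrite (is_derive_unique _ _ _ D), !HB.
(* Regrouping [(n + 1)!] exposes the left side of [c_rec]. *)
rewrite fact_simpl, mult_INR, (Rmult_comm (INR (S n))), Rmult_assoc.
rewrite (c_rec lambda x n); ring.
Qed.
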